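(* Let $n\ge 1$, let $\mathcal{C}\subseteq\mathcal{R}$ be any set of relations, let $X=(x_{ij})\in\mathbb{R}^{\frac{n(n+1)}{2}}$ be a $\mathcal{C}$-pattern, and let $\mathcal{M}_{\mathcal{C}}(X)$ be its associated tiling. Set $\lambda=(x_{n1},\ldots,x_{nn})$ and $\mu=(w_{1}(X),w_{2}(X),\ldots,w_{n}(X))$. Then: (i) The dimension of the minimal face of $P_{\mathcal{C}}$ containing $X$ is equal to the number of tiles in $\mathcal{M}_{\mathcal{C}}(X)$. (ii) The dimension of the minimal face of $P_{\mathcal{C}}(\lambda)$ containing $X$ is equal to the number of $\Lambda_1$-free tiles in $\mathcal{M}_{\mathcal{C}}(X)$. (iii) The dimension of the minimal face of $P_{\mathcal{C}}(\lambda,\mu)$ containing $X$ is equal to the dimension of the kernel of the tiling matrix $A_{\mathcal{M}_{\mathcal{C}}(X)}$.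
   Context: Set $\mathfrak{V}=\{(i,j)\in\mathbb{Z}\times\mathbb{Z}\mid 1\le j\le i\le n\}$; entries of vectors in $\mathbb{R}^{\frac{n(n+1)}{2}}$ are indexed by $\mathfrak{V}$. Let $\mathcal{R}=\mathcal{R}^-\cup\mathcal{R}^0\cup\mathcal{R}^+\subseteq\mathfrak{V}\times\mathfrak{V}$, where $\mathcal{R}^+=\{((i,j);(i-1,t))\mid 2\le i\le n,\ 1\le j\le i,\ 1\le t\le i-1\}$, $\mathcal{R}^-=\{((i,j);(i+1,s))\mid 1\le j\le i\le n-1,\ 1\le s\le i+1\}$, $\mathcal{R}^0=\{((n,i);(n,j))\mid 1\le i\ne j\le n\}$. A set of relations is any subset $\mathcal{C}\subseteq\mathcal{R}$. $G(\mathcal{C})$ is the directed graph with vertex set $\mathfrak{V}$ and an arrow from $(i,j)$ to $(r,s)$ if and only if $((i,j);(r,s))\in\mathcal{C}$. $X\in\mathbb{R}^{\frac{n(n+1)}{2}}$ is a $\mathcal{C}$-pattern if $x_{ij}\ge x_{rs}$ for every $((i,j);(r,s))\in\mathcal{C}$. Put $R_k(X)=\sum_{i=1}^k x_{ki}$ for $1\le k\le n$, $w_1(X)=x_{11}$, and $w_k(X)=R_k(X)-R_{k-1}(X)$ for $2\le k\le n$. For $\lambda,\mu\in\mathbb{R}^n$ define the polyhedra $P_{\mathcal{C}}=\{X\in\mathbb{R}^{\frac{n(n+1)}{2}}\mid X\text{ is a }\mathcal{C}\text{-pattern}\}$, $P_{\mathcal{C}}(\lambda)=\{X\in P_{\mathcal{C}}\mid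 x_{nj}=\lambda_j\text{ for all }1\le j\le n\}$, $P_{\mathcal{C}}(\lambda,\mu)=\{X\in P_{\mathcal{C}}(\lambda)\mid w_i(X)=\mu_i\text{ for all }1\le i\le n\}$. Tiling: for a $\mathcal{C}$-pattern $X$, define an equivalence relation on $\mathfrak{V}$ in which $(i,j)$ is related to $(r,s)$ if and only if there is a walk in $G(\mathcal{C})$ (forgetting the orientation of arrows; the trivial walk is allowed) connecting $(i,j)$ and $(r,s)$ such that the entries of $X$ at all vertices of the walk are equal. The resulting partition $\mathcal{M}_{\mathcal{C}}(X)$ of $\mathfrak{V}$ is the tiling, and its classes are the tiles. With $\Lambda_1=\{n\}$, a tile is $\Lambda_1$-free if it contains no vertex of the form $(n,j)$, $1\le j\le n$. Tiling matrix: if $\mathcal{M}_1,\ldots,\mathcal{M}_s$ ($s\ge1$) are the $\Lambda_1$-free tiles in some chosen order, $A_{\mathcal{M}_{\mathcal{C}}(X)}$ is the real $(n-1)\times s$ matrix with entries $a_{ik}=|\{j\mid (i,j)\in\mathcal{M}_k\}|$, and its kernel is the subspace $\{v\in\mathbb{R}^s\mid A_{\mathcal{M}_{\mathcal{C}}(X)}v=0\}$ (its dimension does not depend on the chosen order). If there are no $\Lambda_1$-free tiles, $A_{\mathcal{M}_{\mathcal{C}}(X)}$ is the identity matrix of order $n-1$. Faces: a polyhedron $P$ in a finite-dimensional real vector space is an intersection of finitely many (possibly zero) closed halfspaces. A support hyperplane of $P$ is a hyperplane $H$ with $H\cap P\ne\emptyset$ such that $P$ lies in one of the two closed halfspaces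 bounded by $H$. A face of $P$ is a set $H\cap P$ with $H$ a support hyperplane; $P$ itself is also counted as a face. The dimension of a face $F$ is the dimension of its affine hull $\mathrm{aff}(F)$. For $x\in P$, the minimal face of $P$ containing $x$ is the unique inclusion-minimal face of $P$ containing $x$ (equivalently, the unique face having $x$ in its relative interior). *)

(* Defs.v *)
From HB Require Import structures.
From mathcomp Require Import all_boot all_order all_algebra.
From mathcomp Require Import boolp classical_sets reals.

Set Implicit Arguments.
Unset Strict Implicit.
Unset Printing Implicit Defensive.

Import Order.TTheory GRing.Theory Num.Theory.
Local Open Scope ring_scope.

Section Faces.
Variables (R : realType) (V : vectType R).
Implicit Types (P F H A : set V) (x : V).

(* [f] is nonzero because [H] has to be a genuine hyperplane. *)
Definition support_hyperplane P H : Prop :=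
  exists (f : 'Hom(V, R^o)) (c : R),
    [/\ f != 0,
        H = [set y | f y = c]%classic,
        (H `&` P !=set0)%classic
      & (P `<=` [set y | (f y : R) <= c])%classic \/
        (P `<=` [set y | c <= (f y : R)])%classic].

Definition is_face P F : Prop :=
  F = P \/ exists2 H, support_hyperplane P H & F = (H `&` P)%classic.

(* Inclusion-minimal only: uniqueness is asserted separately, by applying
   [unique] to [minimal_face P x]. *)
Definition minimal_face P x F : Prop :=
  [/\ is_face P F, F x
    & forall G : set V, is_face P G -> G x -> (G `<=` F)%classic -> G = F].

Definition affine_hull A : set V :=
  [set y | exists (m : nat) (a : 'I_m -> R) (z : 'I_m -> V),
     [/\ forall k, A (z k), \sum_k a k = 1 & y = \sum_k a k *: z k]]%classic.

(* [d] is determined by [A], since [U] consists of the differences of points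
   of the affine hull; no [d] satisfies this when [A] is empty. *)
Definition has_dimension A (d : nat) : Prop :=
  exists (x : V) (U : {vspace V}),
    affine_hull A = [set y | y - x \in U]%classic /\ \dim U = d.

End Faces.

(* Rows and columns are numbered from 0: the vertex called (i, j) in 1-based
   notation, 1 <= j <= i <= n, is the pair (i - 1, j - 1); in particular the
   n-th row has index n.-1. *)
Definition vertex (n : nat) := {p : 'I_n * 'I_n | (p.2 <= p.1)%N}.

Definition vrow n (v : vertex n) : 'I_n := (val v).1.
Definition vcol n (v : vertex n) : 'I_n := (val v).2.

Lemma last_row_proof n (j : 'I_n) : (n.-1 < n)%N.
Proof. by case: n j => [[]|]. Qed.

Lemma last_vertex_proof n (j : 'I_n) : (j <= Ordinal (last_row_proof j))%N.
Proof. by case: n j => [[]//|n] j /=; rewrite -ltnS. Qed.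

Definition last_vertex n (j : 'I_n) : vertex n :=
  exist _ (Ordinal (last_row_proof j), j) (last_vertex_proof j).

Definition rel_plus n : {set vertex n * vertex n} :=
  [set e | vrow e.1 == (vrow e.2).+1 :> nat].
Definition rel_minus n : {set vertex n * vertex n} :=
  [set e | vrow e.2 == (vrow e.1).+1 :> nat].
Definition rel_zero n : {set vertex n * vertex n} :=
  [set e | [&& vrow e.1 == n.-1 :> nat, vrow e.2 == n.-1 :> nat
             & vcol e.1 != vcol e.2]].
Definition relations n : {set vertex n * vertex n} :=
  rel_minus n :|: rel_zero n :|: rel_plus n.

(* R^o makes this space a vectType over R. *)
Notation arrays R n := {ffun vertex n -> R^o}.

Section Patterns.
Variables (R : realType) (n : nat) (C : {set vertex n * vertex n}).
Implicit Types (X : arrays R n) (u v : vertex n).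

Definition arrow : rel (vertex n) := fun u v => (u, v) \in C.

Definition is_pattern X : Prop :=
  forall u v, (u, v) \in C -> (X v : R) <= X u.

Definition row_sum X (k : nat) : R := \sum_(v | vrow v == k :> nat) X v.

(* For k = 0, [row_sum X 0] consists of the only entry of the first row. *)
Definition weight X (k : nat) : R :=
  if k is k'.+1 then row_sum X k'.+1 - row_sum X k' else row_sum X 0.

Definition poly_C : set (arrays R n) := [set X | is_pattern X]%classic.

Definition poly_C1 (lam : 'rV[R]_n) : set (arrays R n) :=
  [set X | poly_C X /\ forall j, X (last_vertex j) = lam 0 j]%classic.

Definition poly_C2 (lam mu : 'rV[R]_n) : set (arrays R n) :=
  [set X | poly_C1 lam X /\ forall i : 'I_n, weight X i = mu 0 i]%classic.

Definition same_tile X : rel (vertex n) := fun u v =>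
  `[< exists p : seq (vertex n),
        [/\ path (fun a b => arrow a b || arrow b a) u p,
            last u p = v
          & forall a, a \in u :: p -> X a = X u] >].

Definition tiling X : {set {set vertex n}} :=
  equivalence_partition (same_tile X) [set: vertex n].

Definition free_tiles X : {set {set vertex n}} :=
  [set T in tiling X | [forall v in T, vrow v != n.-1 :> nat]].

End Patterns.

Section TilingMatrix.
Variables (R : realType) (n : nat).

Definition ncols (ts : seq {set vertex n}) : nat :=
  if ts is [::] then n.-1 else size ts.

(* [ts] lists the free tiles in a chosen order; when there are none, the matrix
   is the identity of order n.-1 by convention. *)
Definition tiling_matrix (ts : seq {set vertex n}) : 'M[R]_(n.-1, ncols ts) :=
  match ts return 'M[R]_(n.-1, ncols ts) with
  | [::] => 1%:M
  | t :: ts' =>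
      \matrix_(i < n.-1, k < size (t :: ts'))
        #|[set v in nth finset.set0 (t :: ts') k | vrow v == i :> nat]|%:R
  end.

Definition mx_kernel m s (A : 'M[R]_(m, s)) : {vspace 'cV[R]_s} :=
  lker (linfun (mulmx A)).

End TilingMatrix.

(* Main.v *)
Require Import Defs.
From HB Require Import structures.
From mathcomp Require Import all_boot all_order all_algebra.
From mathcomp Require Import boolp classical_sets reals.
From mathcomp Require Import ring.

Set Implicit Arguments.
Unset Strict Implicit.
Unset Printing Implicit Defensive.

Import Order.TTheory GRing.Theory Num.Theory.
Local Open Scope ring_scope.

(** All three polyhedra have the form {y | g y = b, f_i y <= c_i for all i} with
    linear [g] and [f_i], where the inequalities are y_v - y_u <= 0 for the arrows
    (u, v). Call the inequality i tight at X when f_i X = c_i. The smallest face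
    through X is obtained by imposing equality in all tight inequalities: adding
    them up gives one valid inequality whose equality case is that set, and any
    support hyperplane through X contains the set, since from X one can move a
    little both towards and away from each of its points
    ([tight_face_unique_minimal]). The same small moves show that its affine hull
    is X + U, where U consists of the d with g d = 0 that are annihilated by all
    tight f_i ([tight_face_dimension]).

    For patterns an arrow (u, v) is tight when X u = X v, so that the tight arrows
    cut out the arrays that are constant on tiles ([tile_constantP]). Hence U is
    computed in coordinates indexed by tiles, the array with tile values a being
    [step a]:
    - without further equations there is one coordinate per tile;
    - prescribing the last row makes an array of U vanish on the tiles meeting
      that row, which leaves one coordinate per free tile ([limg_step_free]);
    - prescribing the weights as well makes the row sums of an array of U vanish.
      The i-th row sum of [step a] is the i-th entry of A a for the tiling matrix A
      ([row_sum_step]), so a runs through the kernel of A ([memv_step_kernel]). *)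

(** * Faces of polyhedra given by linear inequalities *)

(** For a_i, b_i > 0 one needs eps <= b_i / a_i; the inverse of
    1 + sum |a_i| / b_i satisfies all these bounds at once. *)
Lemma exists_small_step (R : realFieldType) (I : finType) (a b : I -> R) :
    (forall i, 0 <= b i) -> (forall i, b i = 0 -> a i = 0) ->
  exists2 eps : R, 0 < eps & forall i, eps * a i <= b i.
Proof.
move=> b_ge0 b0; pose S := 1 + \sum_i `|a i| / b i.
have term_ge0 i : 0 <= `|a i| / b i by rewrite divr_ge0.
have S_gt0 : 0 < S by rewrite ltr_pwDl // sumr_ge0.
exists S^-1 => [|i]; first by rewrite invr_gt0.
have [bi0|bi_neq0] := eqVneq (b i) 0; first by rewrite bi0 b0 // mulr0.
have bi_gt0 : 0 < b i by rewrite lt_neqAle eq_sym bi_neq0 b_ge0.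
rewrite ler_pdivrMl // mulrC -ler_pdivrMl // mulrC.
apply: le_trans (_ : `|a i| / b i <= _).
  by rewrite ler_pM2r ?invr_gt0 ?ler_norm.
by rewrite /S (bigD1 i) //= addrCA lerDl addr_ge0 ?ler01 ?sumr_ge0 //.
Qed.

Section Polyhedron.
Variables (R : realType) (V W : vectType R) (I : finType).
Variables (g : 'Hom(V, W)) (b : W) (f : I -> 'Hom(V, R^o)) (c : I -> R).

Definition polyhedron : set V :=
  [set y | g y = b /\ forall i, (f i y : R) <= c i]%classic.

Definition tight_face (x : V) : set V :=
  [set y | polyhedron y /\
           forall i, (f i x : R) = c i -> (f i y : R) = c i]%classic.

Definition tight_direction (x d : V) : Prop :=
  g d = 0 /\ forall i, (f i x : R) = c i -> f i d = 0.

Variable x : V.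
Hypothesis Px : polyhedron x.

Lemma sub_tight_direction y : tight_face x y -> tight_direction x (y - x).
Proof.
case: Px => gx _ [[gy _] ty]; split=> [|i xi].
  by rewrite linearB /= gx gy subrr.
by rewrite linearB /= ty // xi; apply: subrr.
Qed.

(** The slack inequalities at [x] stay valid along a short enough segment, and
    the tight ones do not change along [d]. *)
Lemma tight_move d : tight_direction x d ->
  exists2 eps : R, 0 < eps & tight_face x (x + eps *: d).
Proof.
case: Px => gx fx [gd fd].
have [i|i /eqP|eps eps_gt0 small] :=
  @exists_small_step _ _ (fun i => f i d : R) (fun i => c i - (f i x : R)).
- by rewrite subr_ge0.
- by rewrite subr_eq0 => /eqP xi; apply: fd.
exists eps => //; split; first split=> [|i].
- by rewrite linearD linearZ /= gd scaler0 addr0.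
- by rewrite linearD linearZ /= -lerBrDl; apply: small.
- by move=> i xi; rewrite linearD linearZ /= (fd i xi) scaler0 addr0.
Qed.

(** The sum h <= m of the tight inequalities is valid on the polyhedron, and
    equality holds in it only if it holds in each summand. If h = 0 then also
    m = 0, so that every point satisfies the equality and the tight face is the
    whole polyhedron. *)
Lemma tight_face_is_face : is_face polyhedron (tight_face x).
Proof.
case: (Px) => gx fx.
pose h := \sum_(i | (f i x : R) == c i) f i.
pose m := \sum_(i | (f i x : R) == c i) c i.
have hE y : (h y : R) = \sum_(i | (f i x : R) == c i) (f i y : R).
  by rewrite sum_lfunE.
have h_le y : polyhedron y -> (h y : R) <= m.
  by case=> _ fy; rewrite hE; apply: ler_sum.
have hx : (h x : R) = m by rewrite hE; apply: eq_bigr => i /eqP.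
have hP y : polyhedron y -> ((h y : R) = m <-> tight_face x y).
  move=> Py; split=> [hy|[_ ty]]; last first.
    by rewrite hE; apply: eq_bigr => i /eqP /ty.
  split=> // i /eqP xi; apply/eqP; rewrite eq_sym -subr_eq0; apply/eqP.
  apply: (psumr_eq0P (P := fun i => (f i x : R) == c i)
                     (F := fun i => c i - (f i y : R))) => //.
    by move=> j _; rewrite subr_ge0; case: Py.
  by rewrite sumrB -hE hy subrr.
have [h0|h_neq0] := eqVneq h 0.
  left; apply/seteqP; split=> y; first by case.
  by move=> Py; apply/(hP y Py); rewrite -hx h0 !lfunE.
right; exists [set y | h y = m]%classic.
  exists h, m; split=> //; first by exists x.
  by left => y /h_le.
apply/seteqP; split=> y; last by case=> hy Py; apply/(hP y Py).
by move=> ty; split; [apply/(hP y) => //; case: ty | case: ty].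
Qed.

(** Let h = m define a support hyperplane through [x], and let [y] be in the tight
    face. Both y and x - eps (y - x) lie in the polyhedron, on opposite sides of
    [x], so that h (y - x) is both nonnegative and nonpositive. *)
Lemma tight_face_smallest G :
  is_face polyhedron G -> G x -> (tight_face x `<=` G)%classic.
Proof.
case=> [-> _ y []//|[H [h [m [_ -> _ side]]] ->] [/= hx _] y ty].
split; last by case: ty.
have := sub_tight_direction ty; set d := y - x => td.
have [|eps eps_gt0 [Pe _]] := @tight_move (- d).
  by case: td => gd fd; split=> [|i xi]; rewrite linearN /= ?gd ?fd // oppr0.
have Py : polyhedron y by case: ty.
have hy : (h y : R) = m + (h d : R).
  by rewrite -hx /d linearB /= addrC subrK.
have he : (h (x + eps *: - d) : R) = m - eps * (h d : R).
  by rewrite linearD linearZ linearN /= hx -mulrN.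
suff hd0 : (h d : R) = 0 by rewrite /= hy hd0 addr0.
apply/eqP; rewrite eq_le.
case: side => side; have := side _ Py; have := side _ Pe;
  rewrite /= hy he ?gerDl ?lerDl ?oppr_le0 ?oppr_ge0.
  by rewrite pmulr_rge0 // => -> ->.
by rewrite pmulr_rle0 // => -> ->.
Qed.

Lemma tight_face_unique_minimal :
  unique (minimal_face polyhedron x) (tight_face x).
Proof.
have F := tight_face_is_face; split; first split=> //.
  by move=> G Gf Gx GF; apply/seteqP; split=> //; apply: tight_face_smallest.
move=> G [Gf Gx Gmin]; apply: Gmin => //.
exact: tight_face_smallest.
Qed.

Lemma tight_face_dimension (U : {vspace V}) :
  (forall d, d \in U <-> tight_direction x d) ->
  has_dimension (tight_face x) (\dim U).
Proof.
move=> UP; exists x, U; split=> //; apply/seteqP; split=> y.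
  case=> m [a [z [tz a1 ->]]] /=.
  have -> : \sum_k a k *: z k - x = \sum_k a k *: (z k - x).
    under [RHS]eq_bigr => k _ do rewrite scalerBr.
    by rewrite sumrB -scaler_suml a1 scale1r.
  apply: memv_suml => k _; apply/memvZ/UP.
  exact: sub_tight_direction.
(* x + d = (1 - 1/eps) x + (1/eps) (x + eps d) for every d in U. *)
move=> /= /UP /[dup] td /tight_move [eps eps_gt0 te].
exists 2, (fun k => if k == ord0 then 1 - eps^-1 else eps^-1),
          (fun k => if k == ord0 then x else x + eps *: (y - x)).
split=> [k||].
- by case: ifP.
- by rewrite !big_ord_recl big_ord0 /= addr0 subrK.
rewrite !big_ord_recl big_ord0 /= addr0 scalerDr scalerA mulVf ?gt_eqF //.
by rewrite scale1r scalerBl scale1r addrA subrK addrC subrK.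
Qed.

End Polyhedron.

(** * Functions constant on the blocks of a partition *)

Section Step.
Variables (R : realType) (T : finType) (Q : {set {set T}}).
Hypothesis Q_part : finset.partition Q [set: T].

Definition step_fun (ts : seq {set T}) (a : 'cV[R]_(size ts)) : {ffun T -> R^o} :=
  [ffun v => \sum_k a k 0 * (v \in nth finset.set0 ts k)%:R].

Fact step_fun_linear ts : linear (@step_fun ts).
Proof.
move=> r a a'; apply/ffunP => v; rewrite !ffunE scaler_sumr -big_split /=.
by apply: eq_bigr => k _; rewrite !mxE mulrDl; congr (_ + _); rewrite -mulrA.
Qed.

HB.instance Definition _ ts :=
  GRing.isLinear.Build R 'cV[R]_(size ts) {ffun T -> R^o} _ (@step_fun ts)
    (@step_fun_linear ts).

Definition step ts : 'Hom('cV[R]_(size ts), {ffun T -> R^o}) :=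
  linfun (@step_fun ts).

Let trivQ : finset.trivIset Q. Proof. by case/and3P: Q_part. Qed.

Variable ts : seq {set T}.
Hypotheses (ts_uniq : uniq ts) (tsQ : {subset ts <= Q}).

Lemma pblock_nth (k : 'I_(size ts)) v :
  v \in nth finset.set0 ts k -> finset.pblock Q v = nth finset.set0 ts k.
Proof. by apply: finset.def_pblock => //; apply/tsQ/mem_nth. Qed.

Lemma step_in (a : 'cV[R]_(size ts)) (k : 'I_(size ts)) v :
  v \in nth finset.set0 ts k -> step ts a v = a k 0.
Proof.
move=> vk; rewrite lfunE ffunE (bigD1 k) //= vk mulr1 big1 ?addr0 // => j jk.
have [vj|] := boolP (v \in _); last by rewrite mulr0.
case/eqP: jk; apply: val_inj; apply/eqP.
rewrite -(nth_uniq finset.set0 (ltn_ord j) (ltn_ord k) ts_uniq).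
by rewrite -(pblock_nth vj) (pblock_nth vk).
Qed.

Lemma step_out (a : 'cV[R]_(size ts)) v :
  finset.pblock Q v \notin ts -> step ts a v = 0.
Proof.
move=> vts; rewrite lfunE ffunE big1 // => k _.
have [vk|] := boolP (v \in _); last by rewrite mulr0.
by case/negP: vts; rewrite (pblock_nth vk) mem_nth.
Qed.

(** A block is nonempty, so its coordinate can be read off at any of its points. *)
Lemma step_ker0 : lker (step ts) = 0%VS.
Proof.
apply/eqP; rewrite -subv0; apply/subvP => a; rewrite memv_ker memv0 => /eqP a0.
apply/eqP/matrixP => k j; rewrite (ord1 j) mxE.
have Qk : nth finset.set0 ts k \in Q by apply/tsQ/mem_nth.
have [v vk] : exists v, v \in nth finset.set0 ts k.
  apply/finset.set0Pn; case/and3P: Q_part => _ _; apply: contraNneq => <-.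
  exact: Qk.
by rewrite -(step_in a vk) a0 ffunE.
Qed.

Lemma memv_step d : d \in limg (step ts) <->
  (forall u v, finset.pblock Q u = finset.pblock Q v -> d u = d v) /\
  (forall v, finset.pblock Q v \notin ts -> d v = 0).
Proof.
have inb v : v \in finset.pblock Q v.
  by rewrite finset.mem_pblock (finset.cover_partition Q_part).
have idx v : finset.pblock Q v \in ts ->
    exists k : 'I_(size ts), v \in nth finset.set0 ts k.
  move=> vts; have lt_v : (index (finset.pblock Q v) ts < size ts)%N.
    by rewrite index_mem.
  by exists (Ordinal lt_v); rewrite /= nth_index.
split=> [/memv_imgP[a _ ->]|[dconst dout]].
  split=> [u v uv|v]; last exact: step_out.
  have [vts|vts] := boolP (finset.pblock Q v \in ts); last by rewrite !step_out ?uv.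
  have [k vk] := idx _ vts; rewrite (step_in a vk) (@step_in a k) //.
  by rewrite -(pblock_nth vk) -uv.
apply/memv_imgP.
exists (\col_k if [pick v in nth finset.set0 ts k] is Some v then d v else 0).
  exact: memvf.
apply/ffunP => v.
have [vts|vts] := boolP (finset.pblock Q v \in ts); last by rewrite dout ?step_out.
have [k vk] := idx _ vts; rewrite (step_in _ vk) mxE.
case: pickP => [u uk|/(_ v)]; last by rewrite vk.
by apply: dconst; rewrite (pblock_nth vk) (pblock_nth uk).
Qed.

Lemma dim_step (U : {vspace 'cV[R]_(size ts)}) : \dim (step ts @: U) = \dim U.
Proof. by apply: limg_dim_eq; rewrite step_ker0 capv0. Qed.

Lemma dim_limg_step : \dim (limg (step ts)) = size ts.
Proof. by rewrite dim_step dimvf /dim /= muln1. Qed.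

End Step.

(** * Tiles *)

Section Tiles.
Variables (R : realType) (n : nat) (C : {set vertex n * vertex n}).
Variable X : arrays R n.
Implicit Types (u v : vertex n) (d : arrays R n).

Lemma same_tile_refl : reflexive (same_tile C X).
Proof.
by move=> u; apply/asboolP; exists [::]; split=> // a; rewrite inE => /eqP ->.
Qed.

Lemma same_tile_sym : symmetric (same_tile C X).
Proof.
suff half u v : same_tile C X u v -> same_tile C X v u.
  by move=> u v; apply/idP/idP; apply: half.
move=> /asboolP[p [up <- eqX]]; apply/asboolP; exists (rev (belast u p)); split.
- by rewrite rev_path; apply: sub_path up => a b /=; rewrite orbC.
- by case: (p) => //= a p'; rewrite rev_cons last_rcons.
have lastp : last u p \in u :: p by apply: mem_last.
move=> a ap; rewrite (eqX _ lastp); apply: eqX.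
by move: ap; rewrite -rev_rcons mem_rev -lastI.
Qed.

Lemma same_tile_trans : transitive (same_tile C X).
Proof.
move=> v u w /asboolP[p [up lp eqp]] /asboolP[q [vq lq eqq]].
have Xv : X v = X u by rewrite -lp; apply/eqp/mem_last.
apply/asboolP; exists (p ++ q); split=> [||a].
- by rewrite cat_path up lp.
- by rewrite last_cat lp.
rewrite -cat_cons mem_cat => /orP[/eqp //|aq].
by rewrite -Xv; apply: eqq; rewrite inE aq orbT.
Qed.

Lemma same_tile_equivalence :
  {in [set: vertex n] & &, equivalence_rel (same_tile C X)}.
Proof.
move=> u v w _ _ _; split=> [|uv]; first exact: same_tile_refl.
apply/idP/idP; last exact: same_tile_trans.
by apply: same_tile_trans; rewrite same_tile_sym.
Qed.

Lemma tiling_partition : finset.partition (tiling C X) [set: vertex n].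
Proof. exact/equivalence_partitionP/same_tile_equivalence. Qed.

Lemma mem_own_tile v : v \in finset.pblock (tiling C X) v.
Proof. by rewrite finset.mem_pblock (finset.cover_partition tiling_partition). Qed.

Lemma own_tile_in v : finset.pblock (tiling C X) v \in tiling C X.
Proof. by apply: pblock_mem; rewrite (finset.cover_partition tiling_partition). Qed.

Lemma eq_own_tile u v :
  (finset.pblock (tiling C X) u == finset.pblock (tiling C X) v) =
  same_tile C X u v.
Proof.
rewrite finset.eq_pblock; last by rewrite (finset.cover_partition tiling_partition).
  by rewrite (pblock_equivalence_partition same_tile_equivalence) ?in_setT.
by case/and3P: tiling_partition.
Qed.

(** Tiles are connected by arrows between equal entries of [X], in either
    direction, so it is enough to compare the values of [d] along such arrows. *)
Lemma tile_constantP d :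
  (forall u v, (u, v) \in C -> X u = X v -> d u = d v) <->
  (forall u v, finset.pblock (tiling C X) u = finset.pblock (tiling C X) v ->
     d u = d v).
Proof.
split=> dC u v; last first.
  move=> uv Xuv; apply/dC/eqP; rewrite eq_own_tile; apply/asboolP.
  exists [:: v]; split=> //=; first by rewrite /arrow uv.
  by move=> a; rewrite !inE => /orP[] /eqP ->.
move/eqP; rewrite eq_own_tile => /asboolP[p [+ <-]] {v}.
elim: p u => //= v p IHp u /andP[uv vp] eqX.
have Xv : X v = X u by apply: eqX; rewrite !inE eqxx orbT.
rewrite -(IHp v vp) => [|a ap]; last by rewrite Xv eqX // inE ap orbT.
by case/orP: uv => uv; [|symmetry]; apply: dC; rewrite ?Xv.
Qed.

Lemma last_vertexE v : vrow v = n.-1 :> nat -> v = last_vertex (vcol v).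
Proof.
move=> vn; apply: val_inj; case: v vn => [[i j] le_ji] /= vn.
by congr (_, _); apply: val_inj.
Qed.

(** A tile that is not free contains some entry of the last row, whose value [d]
    then takes on the whole tile. *)
Lemma free_tile_zeroP d :
    (forall u v, finset.pblock (tiling C X) u = finset.pblock (tiling C X) v ->
       d u = d v) ->
  (forall j, d (last_vertex j) = 0) <->
  (forall v, finset.pblock (tiling C X) v \notin free_tiles C X -> d v = 0).
Proof.
move=> dconst; split=> [dlast v|dout j].
  rewrite inE own_tile_in => /forall_inPn[w wv /negPn/eqP /last_vertexE wlast].
  suff -> : d v = d w by rewrite wlast.
  apply/esym/dconst/finset.def_pblock => //; last exact: own_tile_in.
  by case/and3P: tiling_partition.
apply: dout; rewrite inE own_tile_in; apply/forall_inPn.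
by exists (last_vertex j); [exact: mem_own_tile | rewrite negbK].
Qed.

Lemma free_tiles_sub : {subset free_tiles C X <= tiling C X}.
Proof. by move=> t; rewrite inE => /andP[]. Qed.

End Tiles.

(** * Pattern polyhedra as systems of linear inequalities *)

Section PatternPolyhedra.
Variables (R : realType) (n : nat) (C : {set vertex n * vertex n}).
Implicit Types (d y : arrays R n).

Definition drop_fun (e : vertex n * vertex n) (y : arrays R n) : R^o :=
  y e.2 - y e.1.

Fact drop_fun_linear e : linear (drop_fun e).
Proof. by move=> r y z; rewrite /drop_fun !ffunE scalerBr addrACA opprD. Qed.
HB.instance Definition _ e :=
  GRing.isLinear.Build R (arrays R n) R^o _ (drop_fun e) (drop_fun_linear e).

Definition last_row (y : arrays R n) : 'rV[R]_n := \row_j y (last_vertex j).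

Fact last_row_linear : linear last_row.
Proof. by move=> r y z; apply/rowP => j; rewrite !mxE !ffunE. Qed.
HB.instance Definition _ :=
  GRing.isLinear.Build R (arrays R n) 'rV[R]_n _ last_row last_row_linear.

Lemma row_sum_linear r y z k :
  row_sum (r *: y + z) k = r * row_sum y k + row_sum z k.
Proof.
rewrite /row_sum mulr_sumr -big_split /=.
by apply: eq_bigr => v _; rewrite !ffunE.
Qed.

Definition last_row_weights y : 'rV[R]_n * 'rV[R]_n :=
  (last_row y, \row_(i < n) weight y i).

Fact last_row_weights_linear : linear last_row_weights.
Proof.
move=> r y z; congr (_, _); first exact: last_row_linear.
apply/rowP => i; rewrite !mxE /weight.
by case: (nat_of_ord i) => [|k]; rewrite !row_sum_linear //; ring.
Qed.
HB.instance Definition _ :=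
  GRing.isLinear.Build R (arrays R n) ('rV[R]_n * 'rV[R]_n)%type _
    last_row_weights last_row_weights_linear.

Definition pattern_polyhedron (W : vectType R) (g : 'Hom(arrays R n, W)) b :=
  polyhedron g b (fun e : {e | e \in C} => linfun (drop_fun (val e))) (fun=> 0).

Lemma pattern_polyhedronP (W : vectType R) (g : 'Hom(arrays R n, W)) b y :
  pattern_polyhedron g b y <-> g y = b /\ is_pattern C y.
Proof.
split=> -[gy Cy]; split=> //; last first.
  by case=> -[u v] uv; rewrite lfunE /= /drop_fun /= subr_le0 Cy.
move=> u v uv; have := Cy (exist _ (u, v) uv).
by rewrite lfunE /= /drop_fun /= subr_le0.
Qed.

Lemma weight_eq0P d :
  (forall i : 'I_n, weight d i = 0) <->
  (forall k, (k < n)%N -> row_sum d k = 0).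
Proof.
split=> [dw|dr [[|k] lt_kn]]; last 2 first.
- exact: dr.
- by rewrite /= !dr ?subrr // ltnW.
elim=> [|k IHk] lt_kn; first exact: (dw (Ordinal lt_kn)).
by have := dw (Ordinal lt_kn); rewrite /= IHk ?subr0 // ltnW.
Qed.

Lemma row_sum_last_eq0 d :
  (forall j, d (last_vertex j) = 0) -> row_sum d n.-1 = 0.
Proof.
by move=> dl; rewrite /row_sum big1 // => v /eqP /last_vertexE ->; apply: dl.
Qed.

(** This is where the tiling matrix comes from: its entries are these
    coefficients. *)
Lemma row_sum_step (ts : seq {set vertex n}) (a : 'cV[R]_(size ts)) k :
  row_sum (step R ts a) k =
  \sum_(j < size ts)
    #|[set v in nth finset.set0 ts j | vrow v == k :> nat]|%:R * a j 0.
Proof.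
rewrite /row_sum; under eq_bigr => v _ do rewrite lfunE ffunE.
rewrite exchange_big; apply: eq_bigr => j _.
rewrite -mulr_sumr mulrC -natr_sum; congr (_%:R * _).
rewrite -sum1_card big_mkcond [RHS]big_mkcond.
by apply: eq_bigr => v _; rewrite inE andbC; case: (_ == _); case: (_ \in _).
Qed.

End PatternPolyhedra.

(** * Dimensions of the minimal faces *)

Section FaceDimension.
Variables (R : realType) (n : nat) (C : {set vertex n * vertex n}).
Variable X : arrays R n.
Hypothesis X_pattern : is_pattern C X.

(** Reduces each part of the theorem to computing the space U of the arrays that
    are constant on tiles and killed by the equations [g] of the polyhedron. *)
Lemma pattern_face_dimension (W : vectType R) (g : 'Hom(arrays R n, W))
    (P : set (arrays R n)) (U : {vspace arrays R n}) :
    (forall y, P y <-> g y = g X /\ is_pattern C y) ->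
    (forall d, d \in U <-> g d = 0 /\
       forall u v, finset.pblock (tiling C X) u = finset.pblock (tiling C X) v ->
         d u = d v) ->
  exists2 F, unique (minimal_face P X) F & has_dimension F (\dim U).
Proof.
move=> PE UE.
have -> : P = pattern_polyhedron C g (g X).
  by apply/seteqP; split=> y; rewrite pattern_polyhedronP PE.
have PX : pattern_polyhedron C g (g X) X by apply/pattern_polyhedronP.
eexists; first exact: tight_face_unique_minimal PX.
apply: (tight_face_dimension PX) => d; rewrite UE -tile_constantP.
split=> -[gd dC]; split=> //.
  case=> -[u v] uv; rewrite !lfunE /= /drop_fun /= => /eqP.
  by rewrite subr_eq0 => /eqP Xuv; rewrite (dC u v) // subrr.
move=> u v uv Xuv; have := dC (exist _ (u, v) uv).
rewrite !lfunE /= /drop_fun /= Xuv subrr.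
by move=> /(_ erefl) /eqP; rewrite subr_eq0 => /eqP.
Qed.

Let Q_part := tiling_partition C X.

Lemma limg_step_free ts : perm_eq ts (enum (free_tiles C X)) ->
  forall d, d \in limg (step R ts) <-> last_row d = 0 /\
    forall u v, finset.pblock (tiling C X) u = finset.pblock (tiling C X) v ->
      d u = d v.
Proof.
move=> ts_free d.
have mem_ts : ts =i free_tiles C X.
  by move=> t; rewrite (perm_mem ts_free) mem_enum.
have ts_uniq : uniq ts by rewrite (perm_uniq ts_free) enum_uniq.
have tsQ : {subset ts <= tiling C X}.
  by move=> t; rewrite mem_ts; apply: free_tiles_sub.
have lastP : last_row d = 0 <-> forall j, d (last_vertex j) = 0.
  split=> [/rowP dl j|dl]; first by have := dl j; rewrite !mxE.
  by apply/rowP => j; rewrite !mxE.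
rewrite (memv_step Q_part ts_uniq tsQ) lastP; split=> -[].
  move=> dconst dout; split=> //.
  by apply/(free_tile_zeroP dconst) => v; rewrite -mem_ts; apply: dout.
move=> dlast dconst; split=> // v; rewrite mem_ts; move: v.
exact/(free_tile_zeroP dconst).
Qed.

Lemma memv_mx_kernel m s (A : 'M[R]_(m, s)) a :
  (a \in mx_kernel A) = (A *m a == 0).
Proof. by rewrite memv_ker lfunE. Qed.

Lemma dim_mx_kernel1 m : \dim (mx_kernel (1%:M : 'M[R]_m)) = 0%N.
Proof.
apply/eqP; rewrite dimv_eq0 -subv0; apply/subvP => a.
by rewrite memv_mx_kernel mul1mx memv0.
Qed.

Lemma minimal_face_poly_C :
  exists2 F, unique (minimal_face (poly_C C) X) F
           & has_dimension F #|tiling C X|.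
Proof.
have ts_uniq := enum_uniq (tiling C X).
have tsQ : {subset enum (tiling C X) <= tiling C X} by move=> t; rewrite mem_enum.
rewrite cardE -(dim_limg_step R Q_part ts_uniq tsQ).
apply: (@pattern_face_dimension R^o 0) => [y|d].
  by rewrite !lfunE; split=> [|[]].
rewrite (memv_step Q_part ts_uniq tsQ) lfunE; split=> -[] // _ dconst.
by split=> // v; rewrite mem_enum own_tile_in.
Qed.

Lemma minimal_face_poly_C1 :
  exists2 F, unique (minimal_face (poly_C1 C (last_row X)) X) F
           & has_dimension F #|free_tiles C X|.
Proof.
have ts_uniq := enum_uniq (free_tiles C X).
have tsQ : {subset enum (free_tiles C X) <= tiling C X}.
  by move=> t; rewrite mem_enum; apply: free_tiles_sub.
rewrite cardE -(dim_limg_step R Q_part ts_uniq tsQ).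
apply: (@pattern_face_dimension _ (linfun (@last_row R n))) => [y|d].
  rewrite !lfunE; split=> [[Cy yX]|[yX Cy]]; split=> //.
    by apply/rowP => j; rewrite mxE yX.
  by move=> j; rewrite -yX mxE.
by rewrite limg_step_free // lfunE.
Qed.

(** The tiling matrix only records the first n - 1 rows. This suffices: the last
    row of an array supported on the free tiles is zero, so its sum vanishes. *)
Lemma memv_step_kernel t ts (U := mx_kernel (tiling_matrix R (t :: ts))) :
    perm_eq (t :: ts) (enum (free_tiles C X)) ->
  forall d, d \in (step R (t :: ts) @: U)%VS <->
    last_row_weights d = 0 /\
    forall u v, finset.pblock (tiling C X) u = finset.pblock (tiling C X) v ->
      d u = d v.
Proof.
move=> ts_free d.
have step_free (a : 'cV[R]_(size (t :: ts))) := memv_img (step R (t :: ts)) (memvf a).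
have kerE (a : 'cV[R]_(size (t :: ts))) : a \in U <->
    \row_(i < n) weight (step R (t :: ts) a) i = 0.
  have rowE i : (tiling_matrix R (t :: ts) *m a) i 0 = row_sum (step R (t :: ts) a) i.
    by rewrite row_sum_step mxE; apply: eq_bigr => j _; rewrite mxE.
  have [/rowP last0 _] := (limg_step_free ts_free _).1 (step_free a).
  rewrite memv_mx_kernel; split=> [/eqP Aa|w0].
    apply/rowP => i; rewrite !mxE; move: i; apply/weight_eq0P => k lt_kn.
    have [lt_kn1|] := ltnP k n.-1.
      by rewrite -(rowE (Ordinal lt_kn1)) Aa mxE.
    rewrite -ltnS prednK ?(leq_ltn_trans _ lt_kn) // => le_nk.
    have -> : k = n.-1.
      apply/eqP; rewrite -eqSS prednK ?(leq_ltn_trans _ lt_kn) //.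
      by rewrite eqn_leq lt_kn.
    by apply: row_sum_last_eq0 => j; have := last0 j; rewrite !mxE.
  have /weight_eq0P rs0 : forall i : 'I_n, weight (step R (t :: ts) a) i = 0.
    by move=> j; move/rowP/(_ j): w0; rewrite !mxE.
  apply/eqP/colP => i; rewrite [RHS]mxE rowE rs0 //.
  by rewrite (leq_trans (ltn_ord i)) ?leq_pred.
split=> [/memv_imgP[a Ua ->]|[] [d0 w0] dconst].
  have [l0 aconst] := (limg_step_free ts_free _).1 (step_free a).
  by split=> //; rewrite /last_row_weights l0 (kerE a).1.
have /memv_imgP[a _ dE] := (limg_step_free ts_free d).2 (conj d0 dconst).
by rewrite dE memv_img //; apply/kerE; rewrite -dE.
Qed.

Lemma minimal_face_poly_C2 ts : perm_eq ts (enum (free_tiles C X)) ->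
  exists2 F, unique (minimal_face (poly_C2 C (last_row X)
                                     (\row_i weight X i)) X) F
           & has_dimension F (\dim (mx_kernel (tiling_matrix R ts))).
Proof.
move=> ts_free.
suff [U <- UE] : exists2 U : {vspace arrays R n},
    \dim U = \dim (mx_kernel (tiling_matrix R ts)) &
    forall d, d \in U <-> last_row_weights d = 0 /\
      forall u v, finset.pblock (tiling C X) u = finset.pblock (tiling C X) v ->
        d u = d v.
  apply: (@pattern_face_dimension _ (linfun (@last_row_weights R n))) => [y|d].
    rewrite !lfunE; split=> [[[Cy yX] wX]|[[yX wX] Cy]].
      split=> //; congr (_, _); apply/rowP => j; first by rewrite mxE yX.
      by rewrite mxE wX.
    split; first split=> // j; first by rewrite -yX mxE.
    by move=> i; rewrite -wX mxE.
  by rewrite UE lfunE.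
case: ts ts_free => [|t ts] ts_free.
  (* Without free tiles U is zero, and so is the kernel of the identity matrix. *)
  exists 0%VS; first by rewrite dim_mx_kernel1 dimv0.
  move=> d; rewrite memv0; split=> [/eqP ->|[] [d0 w0] dconst].
    by split=> [|u v _]; rewrite ?ffunE //; exact: linear0.
  have /memv_imgP[a _ ->] := (limg_step_free ts_free d).2 (conj d0 dconst).
  by apply/eqP/ffunP => v; rewrite lfunE !ffunE big_ord0.
exists (step R (t :: ts) @: mx_kernel (tiling_matrix R (t :: ts)))%VS.
  rewrite (dim_step Q_part) //; first by rewrite (perm_uniq ts_free) enum_uniq.
  by move=> u; rewrite (perm_mem ts_free) mem_enum; apply: free_tiles_sub.
exact: memv_step_kernel.
Qed.

End FaceDimension.

Theorem theorem5p7 (R : realType) (n : nat) (n_ge1 : (1 <= n)%N)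
    (C : {set vertex n * vertex n}) (C_rel : C \subset relations n)
    (X : arrays R n) (X_pattern : is_pattern C X) :
  let lam : 'rV[R]_n := \row_j X (last_vertex j) in
  let mu : 'rV[R]_n := \row_i weight X i in
  [/\ exists2 F : set (arrays R n),
        unique (minimal_face (poly_C C) X) F &
        has_dimension F #|tiling C X|,
      exists2 F : set (arrays R n),
        unique (minimal_face (poly_C1 C lam) X) F &
        has_dimension F #|free_tiles C X|
    & forall ts : seq {set vertex n}, perm_eq ts (enum (free_tiles C X)) ->
      exists2 F : set (arrays R n),
        unique (minimal_face (poly_C2 C lam mu) X) F &
        has_dimension F (\dim (mx_kernel (tiling_matrix R ts)))].
Proof.
move=> lam mu; split.
- exact: minimal_face_poly_C.
- exact: minimal_face_poly_C1.
- by move=> ts; apply: minimal_face_poly_C2.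
Qed.
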